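(* Let $n\ge 1$ and let $\mathrm{Fl} = \{\mathrm{fl}_1,\dots,\mathrm{fl}_n\}$ and $\mathrm{R} = \{\mathrm{r}_0,\dots,\mathrm{r}_n\}$ be tuples of functions which round to nearest in an MPFR system with unit roundoff $u$. If $20 n u\leq 1$ and $\mathbf{x},\mathbf{y}\in\mathbb{R}^{n+1}$, then $$\left| \mathrm{dot}_{\mathrm{Fl},\mathrm{R}}\left(\sum_{k=0}^n x_k y_k\right) - \sum_{k=0}^n x_k y_k\right| \leq \frac{(2.05\,n+1.05)\,\alpha}{2} + \beta_n u\sum_{k=0}^n |x_k y_k|,$$ where $\beta_n := \dfrac{n+1+3nu}{1+(n+1)u+nu^2}$. If, additionally, $u\sum_{k=0}^n|x_ky_k|\geq\alpha$, then $$\left| \mathrm{dot}_{\mathrm{Fl},\mathrm{R}}\left(\sum_{k=0}^n x_k y_k\right) - \sum_{k=0}^n x_k y_k\right| \leq \frac{3}{2}(n+1)u\sum_{k=0}^n |x_k y_k|.$$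
   Context: Let $\beta \ge 2$ be an integer (the base; not to be confused with the numbers $\beta_n$ of the claim) and $\mu \ge 1$ an integer. The unit roundoff is $u := 1/(2\beta^{\mu})$. For $e\in\mathbb{Z}$ let $\mathcal{E}_e := \{\beta^e(\beta^\mu + r) : r = 0,1,\dots,(\beta-1)\beta^\mu - 1\}$. For an integer $e_\alpha < -\mu$, the MPFR system associated to $\beta,\mu,e_\alpha$ is $\mathcal{M} := \{0\}\cup\bigcup_{e\ge e_\alpha} (\mathcal{E}_e \cup -\mathcal{E}_e)$, and for it $\alpha := \beta^{e_\alpha+\mu}$. A function $\mathrm{fl}:\mathbb{R}\to\mathbb{R}$ rounds to nearest in a system $\mathcal{F}$ if for all $z\in\mathbb{R}$ one has $\mathrm{fl}(z)\in\mathcal{F}$ and $|\mathrm{fl}(z)-z|\le|x-z|$ for all $x\in\mathcal{F}$ (ties may be broken arbitrarily). A tuple rounds to nearest in $\mathcal{F}$ if each of its elements does (the elements may differ). Floating point sum: for real $p_0,\dots,p_n$, put $\hat s_1 := \mathrm{fl}_1(p_0+p_1)$ and $\hat s_k := \mathrm{fl}_k(\hat s_{k-1}+p_k)$ for $2\le k\le n$. Then $\mathrm{Fl}\left(\sum_{k=0}^n p_k\right) := \hat s_n$. Floating point dot product: $\mathrm{dot}_{\mathrm{Fl},\mathrm{R}}\left(\sum_{k=0}^n x_ky_k\right) := \mathrm{Fl}\left(\sum_{k=0}^n \mathrm{r}_k(x_ky_k)\right)$. *)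

(* Defs.v *)
From mathcomp Require Import all_boot all_order all_algebra.
From mathcomp Require Import classical_sets reals.

Set Implicit Arguments.
Unset Strict Implicit.
Unset Printing Implicit Defensive.

Import Order.TTheory GRing.Theory Num.Theory.

Local Open Scope classical_set_scope.
Local Open Scope ring_scope.

Definition unit_roundoff (R : realType) (beta mu : nat) : R :=
  1 / (2 * beta%:R ^+ mu).

Definition binade (R : realType) (beta mu : nat) (e : int) : set R :=
  [set z | exists2 r : nat, (r < (beta - 1) * beta ^ mu)%N
           & z = beta%:R ^ e * (beta%:R ^+ mu + r%:R)].

Definition mpfr (R : realType) (beta mu : nat) (e_alpha : int) : set R :=
  [set 0] `|`
  \bigcup_(e in [set e : int | e_alpha <= e])
     (binade beta mu e `|` -%R @` binade beta mu e).

Definition mpfr_alpha (R : realType) (beta mu : nat) (e_alpha : int) : R :=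
  beta%:R ^ (e_alpha + mu%:Z).

Definition rounds_to_nearest (R : realType) (F : set R) (fl : R -> R) : Prop :=
  forall z : R, F (fl z) /\ forall x : R, F x -> `|fl z - z| <= `|x - z|.

(* The rounding functions are indexed from 0: [fl k], with [k : 'I_n], is the
   one used at the (k+1)-st addition, whose second operand [p (lift ord0 k)]
   is the term of index k+1. *)
Definition fl_sum (R : realType) (n : nat) (fl : 'I_n -> R -> R)
    (p : 'I_n.+1 -> R) : R :=
  foldl (fun s k => fl k (s + p (lift ord0 k))) (p ord0) (enum 'I_n).

Definition fl_dot (R : realType) (n : nat) (fl : 'I_n -> R -> R)
    (rd : 'I_n.+1 -> R -> R) (x y : 'rV[R]_n.+1) : R :=
  fl_sum fl (fun k => rd k (x 0 k * y 0 k)).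

Definition beta_coef (R : realType) (n : nat) (u : R) : R :=
  (n%:R + 1 + 3 * n%:R * u) / (1 + (n%:R + 1) * u + n%:R * u ^+ 2).

Lemma fl_sum0 (R : realType) (fl : 'I_0 -> R -> R) (p : 'I_1 -> R) :
  fl_sum fl p = p ord0.
Proof. by rewrite /fl_sum (size0nil (size_enum_ord 0)). Qed.

Lemma fl_sumS (R : realType) (n : nat) (fl : 'I_n.+1 -> R -> R)
    (p : 'I_n.+2 -> R) :
  fl_sum fl p =
  fl ord_max (fl_sum (fun k => fl (widen_ord (leqnSn n) k))
                     (fun k => p (widen_ord (leqnSn n.+1) k)) + p ord_max).
Proof.
rewrite /fl_sum enum_ordSr foldl_rcons; congr (fl _ (_ + p _)); last first.
  exact/val_inj.
have -> : widen_ord (leqnSn n.+1) ord0 = ord0 by exact/val_inj.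
elim/last_ind: (enum 'I_n) => [//|s k IH].
rewrite map_rcons !foldl_rcons IH; congr (fl _ (_ + p _)).
exact/val_inj.
Qed.

(* Main.v *)
Require Import Defs.
From mathcomp Require Import all_boot all_order all_algebra.
From mathcomp Require Import classical_sets reals.
From mathcomp Require Import ring lra.

Import Order.TTheory GRing.Theory Num.Theory.
Local Open Scope ring_scope.

(** Write [s k] for the computed partial sums of the rounded products [p k],
    [z k = s k + p (k + 1)] for the exact results that get rounded, and [d k]
    for the rounding error of step [k]. The total error of the summation is at
    most the sum of the [d k]. Let [M] be the power of [beta] with
    [M <= Z < beta * M], where [Z] is the largest [|z k|].

    If [Z < alpha], or if [u * M < alpha / 2], every [d k] is at most
    [alpha / 2], so the error is at most [n * alpha / 2].

    Otherwise every [d k] is at most [u * M], and the sharp constant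
    [n u / (1 + n u)] comes from the first step [j] with [M <= |z j|]. Before
    [j] the results lie in lower binades, where the errors are at most
    [u * M / 2]; call [e] their sum. At [j] the error is also at most
    [|z j| - M], since [M] is a float, and after [j] each error is also at most
    the added term. Thus, with [T] the sum of the errors from [j] on, the terms
    have total mass at least [M + T - e], while [2 e + T <= n u M]. When
    [2 n u <= 1] these two facts give
    [(1 + n u) (e + T) <= n u (M + T - e)], which is the bound
    [e + T <= n u / (1 + n u) * mass]. An underflow before [j] can be counted in
    [T]: it happens only when two floats of size at least [alpha] nearly
    cancel, and then the mass they lose pays for the error
    ([nearest_underflow_cancel]). This is [sum_error_invariant], and the
    summation bound is [float_sum_error]: the error is at most the maximum, and
    not merely the sum, of [n u / (1 + n u) * mass] and [n * alpha / 2].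

    Rounding a product [q] costs at most [u / (1 + u) * |q| + alpha / 2].
    Composing the two bounds gives the coefficient [beta_coef n u]. The second
    estimate depends on the maximum: either the summation error has no
    underflow part, and [beta_coef_le] leaves room for the [n + 1] underflows
    of the products, or it has only an underflow part, and then the [2 n + 1]
    half-[alpha]s and the relative errors of the products fit directly. *)

(** * The floating point grid *)

Section RoundingToNearest.

Context {R : realType} {beta mu : nat} {e_alpha : int}.
Context (beta_ge2 : (2 <= beta)%N).

Local Notation F := (mpfr (R := R) beta mu e_alpha).
Local Notation u := (unit_roundoff R beta mu).
Local Notation alpha := (mpfr_alpha R beta mu e_alpha).
Local Notation b := (beta%:R : R).

(** The relation between one argument and its rounded value, because every
    operation of a sum or of a dot product has its own rounding function. *)
Definition nearest (S : set R) (z w : R) : Prop :=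
  S w /\ forall x : R, S x -> `|w - z| <= `|x - z|.

Lemma base_ge2 : 2 <= b.
Proof. by rewrite ler_nat. Qed.

Lemma base_gt0 : 0 < b.
Proof. by have := base_ge2; lra. Qed.

Lemma alpha_gt0 : 0 < alpha.
Proof. by rewrite exprz_gt0 // base_gt0. Qed.

Lemma roundoff_gt0 : 0 < u.
Proof. by rewrite divr_gt0 // mulr_gt0 // exprn_gt0 // base_gt0. Qed.

Lemma binade_alphaE (m : nat) :
  alpha * b ^+ m = b ^ (e_alpha + m%:Z) * b ^+ mu.
Proof.
have b0 : b != 0 by rewrite gt_eqF // base_gt0.
by rewrite /mpfr_alpha !expfzDr // -!exprnP mulrAC.
Qed.

(** Floats are spaced by [beta ^ (e_alpha + m)] in the binade that starts at
    [alpha * beta ^ m], so [u] times that start is half a spacing. *)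
Lemma half_ulpE (m : nat) : u * (alpha * b ^+ m) = b ^ (e_alpha + m%:Z) / 2.
Proof.
have b0 : b ^+ mu != 0 by rewrite expf_neq0 // gt_eqF // base_gt0.
rewrite binade_alphaE /unit_roundoff; by field; exact: b0.
Qed.

Lemma mpfr0 : F 0.
Proof. by left. Qed.

Lemma mpfrN (x : R) : F x -> F (- x).
Proof.
case=> [->|[e he [hx|[y hy <-]]]]; first by rewrite oppr0; left.
- by right; exists e => //; right; exists x.
- by right; exists e => //; left; rewrite opprK.
Qed.

(** The bound on [r] is not strict: the last value is the start of the next
    binade, which is what makes the right neighbour of any point of a binade
    a float. *)
Lemma mpfr_grid (m r : nat) : (r <= (beta - 1) * beta ^ mu)%N ->
  F (b ^ (e_alpha + m%:Z) * (b ^+ mu + r%:R)).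
Proof.
have b0 : b != 0 by rewrite gt_eqF // base_gt0.
have he : e_alpha <= e_alpha + m%:Z by rewrite lerDl.
rewrite leq_eqVlt => /orP[/eqP ->|hr]; last first.
  by right; exists (e_alpha + m%:Z) => //; left; exists r.
right; exists (e_alpha + m.+1%:Z); first by rewrite /= lerDl.
left; exists 0%N.
  by rewrite muln_gt0 subn_gt0 beta_ge2 expn_gt0 (ltnW beta_ge2).
rewrite natrM natrX natrB ?(ltnW beta_ge2) //.
rewrite !expfzDr // -!exprnP exprS; ring.
Qed.

Lemma mpfr_binade_start (m : nat) : F (alpha * b ^+ m).
Proof. by have := mpfr_grid m 0 isT; rewrite addr0 -binade_alphaE. Qed.

Lemma mpfr_norm_ge (x : R) : F x -> x != 0 -> alpha <= `|x|.
Proof.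
have b1 : 1 <= b by have := base_ge2; lra.
have key e y : e_alpha <= e -> binade beta mu e y -> alpha <= y.
  move=> he [r _ ->]; rewrite /mpfr_alpha expfzDr ?gt_eqF ?base_gt0 // -exprnP.
  have b0 := ltW base_gt0.
  apply: ler_pM; rewrite ?exprn_ge0 ?exprz_ge0 ?lerDl //.
  exact: ler_weXz2l.
case=> [->|[e he [hx|[y hy <-]]]] /=; first by rewrite eqxx.
- by move=> _; apply: le_trans (key _ _ he hx) (ler_norm _).
- by move=> _; rewrite normrN; apply: le_trans (key _ _ he hy) (ler_norm _).
Qed.

Lemma mpfr_near_pos (m : nat) (z : R) :
  alpha * b ^+ m <= z -> z < alpha * b ^+ m.+1 ->
  exists2 x, F x & `|x - z| <= u * (alpha * b ^+ m).
Proof.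
set g := b ^ (e_alpha + m%:Z) => zlo zhi.
have g0 : 0 < g by rewrite exprz_gt0 // base_gt0.
have tlo : b ^+ mu <= z / g.
  by rewrite ler_pdivlMr // mulrC -binade_alphaE.
have thi : z / g < b ^+ mu.+1.
  rewrite ltr_pdivrMr //; move: zhi.
  by rewrite exprSr mulrA binade_alphaE -/g exprSr mulrAC mulrC mulrA mulrAC.
have t0 : 0 <= z / g.
  by apply: le_trans tlo; rewrite exprn_ge0 // ltW // base_gt0.
pose q := Num.truncn (z / g).
have /andP[qlo qhi] := truncn_itv t0; rewrite -/q in qlo qhi.
have qge : (beta ^ mu <= q)%N by rewrite truncn_ge_nat // natrX.
have qlt : (q < beta ^ mu.+1)%N by rewrite truncn_lt_nat // natrX.
pose r := (q - beta ^ mu)%N.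
have rlt : (r < (beta - 1) * beta ^ mu)%N.
  rewrite /r ltn_subLR // mulnBl mul1n subnKC ?leq_pmull ?(ltnW beta_ge2) //.
  by rewrite -expnS.
have qE : q%:R = b ^+ mu + r%:R :> R.
  by rewrite -natrX -natrD subnKC.
have zE : z = g * (z / g) by rewrite mulrC divfK // gt_eqF.
rewrite half_ulpE -/g.
have [h|h] := lerP (z / g - q%:R) (1 / 2).
- exists (g * q%:R); first by rewrite qE; apply: mpfr_grid; exact: ltnW.
  rewrite {1}zE -mulrBr normrM gtr0_norm // distrC ger0_norm; last lra.
  by rewrite ler_pM2l //; lra.
- exists (g * q.+1%:R).
    by rewrite -addn1 natrD qE -addrA -natrD; apply: mpfr_grid; rewrite addn1.
  rewrite {1}zE -mulrBr normrM gtr0_norm // ger0_norm; last first.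
    by rewrite subr_ge0 ltW.
  by rewrite ler_pM2l // -addn1 natrD; lra.
Qed.

(** The exponent is found by applying the integer logarithm to the integer part
    of [|z| / alpha]. *)
Lemma binade_exists (z : R) : alpha <= `|z| ->
  exists m : nat, alpha * b ^+ m <= `|z| < alpha * b ^+ m.+1.
Proof.
have a0 := alpha_gt0; move=> hz.
have t1 : 1 <= `|z| / alpha by rewrite ler_pdivlMr // mul1r.
have t0 : 0 <= `|z| / alpha by lra.
have /andP[lo hi] := truncn_itv t0.
pose q := Num.truncn (`|z| / alpha).
have q0 : (0 < q)%N by rewrite truncn_gt0.
have /andP[l2 h2] := trunc_log_bounds beta_ge2 q0.
exists (trunc_log beta q); apply/andP; split.
  rewrite mulrC -ler_pdivlMr //; apply: le_trans lo.
  by rewrite -natrX ler_nat.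
rewrite mulrC -ltr_pdivrMr //; apply: lt_le_trans hi _.
by rewrite -natrX ler_nat.
Qed.

(** * The error of one rounding *)

Lemma nearestN (z w : R) : nearest F z w -> nearest F (- z) (- w).
Proof.
move=> [Fw hw]; split; first exact: mpfrN.
move=> x /mpfrN Fx; rewrite -opprD normrN.
by apply: le_trans (hw _ Fx) _; rewrite -normrN opprD opprK.
Qed.

(** The first bound is half a spacing. The second compares with the start of the
    binade, which is a float; it is what makes a sum that barely enters a
    binade almost exact. *)
Lemma nearest_binade (m : nat) (z w : R) : nearest F z w ->
  alpha * b ^+ m <= `|z| -> `|z| < alpha * b ^+ m.+1 ->
  `|w - z| <= u * (alpha * b ^+ m) /\ `|w - z| <= `|z| - alpha * b ^+ m.
Proof.
wlog z0 : z w / 0 <= z => [hw|].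
  have [z0|z0] := lerP 0 z; first exact: hw.
  move=> /nearestN hn; rewrite -normrN -[`|w - z|]normrN opprB.
  move=> l h; have -> : z - w = - w - - z by ring.
  by apply: hw => //; lra.
rewrite (ger0_norm z0) => -[Fw hw] l h; split.
  have [x Fx hx] := mpfr_near_pos m z l h.
  exact: le_trans (hw _ Fx) hx.
apply: le_trans (hw _ (mpfr_binade_start m)) _.
by rewrite distrC ger0_norm // subr_ge0.
Qed.

(** The floats next to [z] are [0] and one of [alpha], [- alpha]: there are no
    subnormal numbers. *)
Lemma nearest_underflow (z w : R) : nearest F z w -> `|z| < alpha ->
  `|w - z| <= alpha / 2.
Proof.
move=> [Fw hw] h.
have h0 := hw _ mpfr0.
have Fa : F alpha by have := mpfr_binade_start 0; rewrite expr0 mulr1.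
have h1 := hw _ Fa.
have h2 := hw _ (mpfrN _ Fa).
move: h0 h1 h2 h; rewrite sub0r normrN.
have [z0|z0] := ger0P z.
  by move=> h0 + _ h; rewrite (@ger0_norm _ (alpha - z)) => *; lra.
by move=> h0 _ + h; rewrite (@ler0_norm _ (- alpha - z)) => *; lra.
Qed.

(** The float [s] itself is a candidate for the rounded value of [s + p]. *)
Lemma nearest_le_term (s p w : R) : nearest F (s + p) w -> F s ->
  `|w - (s + p)| <= `|p|.
Proof.
move=> [_ hw] Fs; apply: le_trans (hw _ Fs) _.
by rewrite opprD addNKr normrN.
Qed.

(** If the rounding is not exact then [s] and [p] are nonzero floats, hence both
    at least [alpha] in absolute value, whereas the result has absolute value
    at most [alpha] and the error is at most [alpha / 2]. In a summation this
    says that the mass destroyed by cancellation pays for the underflow. *)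
Lemma nearest_underflow_cancel (s p w : R) : F s -> F p ->
  nearest F (s + p) w -> `|s + p| < alpha ->
  `|w| + `|w - (s + p)| <= `|s| + `|p|.
Proof.
move=> Fs Fp hw h; have a0 := alpha_gt0.
have exact_case x : F x -> nearest F x w -> `|w| + `|w - x| <= `|x|.
  move=> Fx [_ /(_ _ Fx)]; rewrite subrr normr0 normr_le0 subr_eq0 => /eqP ->.
  by rewrite subrr normr0 addr0.
have [s0|s0] := eqVneq s 0.
  by move: hw; rewrite s0 add0r normr0 add0r; apply: exact_case.
have [p0|p0] := eqVneq p 0.
  by move: hw; rewrite p0 addr0 normr0 addr0; apply: exact_case.
have h1 := mpfr_norm_ge _ Fs s0; have h2 := mpfr_norm_ge _ Fp p0.
have h3 := nearest_underflow _ _ hw h.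
have wa : `|w| <= alpha.
  rewrite leNgt; apply/negP => wa.
  case: hw => _ hw.
  have Fa : F alpha by have := mpfr_binade_start 0; rewrite expr0 mulr1.
  have ha := hw _ Fa; have hna := hw _ (mpfrN _ Fa).
  move: ha hna h wa; rewrite !ler_norml !ltr_norml.
  case: (ler0P w) => w0; case: (ler0P (w - (s+p))) => ?;
  case: (ler0P (alpha - (s+p))) => ?; case: (ler0P (-alpha - (s+p))) => ?; lra.
lra.
Qed.

Lemma binade_lt (m m' : nat) (z : R) :
  alpha * b ^+ m' <= z -> z < alpha * b ^+ m -> (m' < m)%N.
Proof.
move=> lo hi; have b1 : 1 < b by have := base_ge2; lra.
by have := le_lt_trans lo hi; rewrite ltr_pM2l ?alpha_gt0 // ltr_eXn2l.
Qed.

(** The binade of [z] starts at most at [alpha * b ^+ m / b], and [b] is at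
    least 2. *)
Lemma nearest_below_binade (m : nat) (z w : R) : nearest F z w ->
  alpha <= `|z| -> `|z| < alpha * b ^+ m ->
  `|w - z| <= u * (alpha * b ^+ m) / 2.
Proof.
move=> hw zlo zhi; have [m' /andP[lo hi]] := binade_exists z zlo.
apply: le_trans (nearest_binade _ _ _ hw lo hi).1 _.
have mm := binade_lt _ _ _ lo zhi.
have pw : 2 * b ^+ m' <= b ^+ m.
  apply: (@le_trans _ _ (b ^+ m'.+1)).
    by rewrite exprS ler_pM2r ?exprn_gt0 ?base_gt0 ?base_ge2.
  by apply: ler_weXn2l => //; have := base_ge2; lra.
have ua : 0 < u * alpha by rewrite mulr_gt0 ?roundoff_gt0 ?alpha_gt0.
have := ler_wpM2l (ltW ua) pw; lra.
Qed.

Lemma nearest_upto_binade (m : nat) (z w : R) : nearest F z w ->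
  `|z| < alpha * b ^+ m.+1 ->
  `|w - z| <= Num.max (u * (alpha * b ^+ m)) (alpha / 2).
Proof.
move=> hw zhi; rewrite le_max.
have [zlo|zlo] := ltrP `|z| alpha.
  by rewrite (nearest_underflow _ _ hw zlo) orbT.
have [h|h] := ltrP `|z| (alpha * b ^+ m); last first.
  by rewrite (nearest_binade _ _ _ hw h zhi).1.
apply/orP; left; apply: le_trans (nearest_below_binade _ _ _ hw zlo h) _.
have M0 : 0 < alpha * b ^+ m.
  by rewrite mulr_gt0 ?exprn_gt0 ?base_gt0 ?alpha_gt0.
have : 0 < u * (alpha * b ^+ m) by rewrite mulr_gt0 ?roundoff_gt0.
lra.
Qed.

(** For normal [z] in the binade starting at [M] the error is at most both
    [u * M] and [|z| - M]; adding the first bound and [u] times the second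
    eliminates [M] and yields the constant [u / (1 + u)]. *)
Lemma nearest_relative (z w : R) : nearest F z w ->
  `|w - z| <= u / (1 + u) * `|z| + alpha / 2.
Proof.
have u0 := roundoff_gt0; have a0 := alpha_gt0; move=> hw.
have [zlo|zlo] := ltrP `|z| alpha.
  apply: le_trans (nearest_underflow _ _ hw zlo) _.
  by rewrite lerDr mulr_ge0 // divr_ge0 //; lra.
have [m /andP[lo hi]] := binade_exists z zlo.
have [h1 h2] := nearest_binade _ _ _ hw lo hi.
apply: (@le_trans _ _ (u / (1 + u) * `|z|)); last lra.
rewrite mulrAC ler_pdivlMr; last lra.
have := ler_wpM2l (ltW u0) h2; lra.
Qed.

(** * Recursive summation of floats *)

Section Summation.

Context {n : nat} {p s : nat -> R}.
Context (Fp : forall k, (k <= n)%N -> F (p k)) (s0 : s 0%N = p 0%N).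
Context (s_step : forall k, (k < n)%N -> nearest F (s k + p k.+1) (s k.+1)).

Local Notation err k := (s k - \sum_(i < k.+1) p i).
Local Notation mass k := (\sum_(i < k.+1) `|p i|).

Lemma partial_sum_mpfr (k : nat) : (k <= n)%N -> F (s k).
Proof.
by case: k => [|k] hk; [rewrite s0; exact: Fp | case: (s_step k hk)].
Qed.

Lemma errS (k : nat) : err k.+1 = err k + (s k.+1 - (s k + p k.+1)).
Proof. by rewrite big_ord_recr /=; ring. Qed.

Lemma sum_error_uniform (D : R) (k : nat) :
  (forall i, (i < n)%N -> `|s i.+1 - (s i + p i.+1)| <= D) ->
  (k <= n)%N -> `|err k| <= k%:R * D.
Proof.
move=> hD; elim: k => [_|k IH hk].
  by rewrite big_ord_recr big_ord0 /= s0 add0r subrr normr0 mul0r.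
rewrite errS; apply: le_trans (ler_normD _ _) _.
rewrite -addn1 natrD mulrDl mul1r addn1.
by apply: lerD; [exact: IH (ltnW hk) | exact: hD].
Qed.

(** Here [e] collects the normal errors committed while all intermediate results
    are below [M = alpha * b ^+ m], and [T] all the other errors. The factor 2
    on [e] records that the former are at most [u * M / 2]. The left alternative
    holds once some result has reached [M]; it persists because later errors
    are at most the added terms. In the right one [|s k|] stands for [M], and
    comparing it with [M] at the first large result gives the left one. *)
Lemma sum_error_invariant (m k : nat) :
  alpha / 2 <= u * (alpha * b ^+ m) -> (k <= n)%N ->
  (forall i, (i < n)%N -> `|s i + p i.+1| < alpha * b ^+ m.+1) ->
  exists e T, [/\ 0 <= e, 0 <= T, `|err k| <= e + T,
    2 * e + T <= k%:R * (u * (alpha * b ^+ m)) &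
    alpha * b ^+ m + T <= mass k + e \/
    (forall i, (i < k)%N -> `|s i + p i.+1| < alpha * b ^+ m) /\
      `|s k| + T <= mass k + e].
Proof.
set M := alpha * b ^+ m => hM + hi.
elim: k => [_|k IH hk].
  exists 0, 0; split=> //; rewrite ?mulr0 ?addr0 ?mul0r //.
    by rewrite big_ord_recr big_ord0 /= s0 add0r subrr normr0.
  by right; split=> //; rewrite big_ord_recr big_ord0 /= add0r s0.
have [e [T [e0 T0 hE hB hP]]] := IH (ltnW hk).
have near := s_step k hk.
have Fs := partial_sum_mpfr k (ltnW hk).
have dp := nearest_le_term _ _ _ near Fs.
have := nearest_upto_binade m _ _ near (hi k hk).
rewrite -/M (max_idPl hM) => dM.
have d0 := normr_ge0 (s k.+1 - (s k + p k.+1)).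
have hE' : `|err k.+1| <= e + T + `|s k.+1 - (s k + p k.+1)|.
  by rewrite errS; apply: le_trans (ler_normD _ _) _; rewrite lerD2r.
have kS : k.+1%:R * (u * M) = k%:R * (u * M) + u * M.
  by rewrite -addn1 natrD mulrDl mul1r.
have massS : mass k.+1 = mass k + `|p k.+1| by rewrite big_ord_recr.
have tri := ler_normD (s k) (p k.+1).
rewrite massS kS; set d := `|s k.+1 - _| in dp dM d0 hE' *.
case: hP => [hP|[hlt hP]].
  by exists e, (T + d); split; [| | | |left]; lra.
have [zM|zM] := ltrP `|s k + p k.+1| M; last first.
  (* the result reaches [M] for the first time *)
  have := (nearest_binade m _ _ near zM (hi k hk)).2; rewrite -/d -/M => dz.
  by exists e, (T + d); split; [| | | |left]; lra.
have hlt' i : (i < k.+1)%N -> `|s i + p i.+1| < M.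
  by rewrite ltnS leq_eqVlt => /orP[/eqP ->|/hlt].
have [za|za] := ltrP `|s k + p k.+1| alpha.
  have := nearest_underflow_cancel _ _ _ Fs (Fp _ hk) near za; rewrite -/d => c.
  by exists e, (T + d); split; [| | | |right; split=> //]; lra.
have := nearest_below_binade m _ _ near za zM; rewrite -/d -/M => d2.
have tri2 : `|s k.+1| <= `|s k + p k.+1| + d.
  have -> : s k.+1 = (s k + p k.+1) + (s k.+1 - (s k + p k.+1)) by ring.
  exact: ler_normD.
by exists (e + d), T; split; [| | | |right; split=> //]; lra.
Qed.

(** The binade of the largest intermediate result decides which term of the
    maximum is the bound. *)
Lemma float_sum_error : 2 * n%:R * u <= 1 ->
  `|err n| <=
    Num.max (n%:R * u / (1 + n%:R * u) * mass n) (n%:R * (alpha / 2)).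
Proof.
have u0 := roundoff_gt0; have a0 := alpha_gt0; move=> hu; rewrite le_max.
have nu0 : 0 <= n%:R * u by rewrite mulr_ge0 // ltW.
suff [h|[m [h [k hk kM] hi]]] :
  (forall k, (k < n)%N -> `|s k.+1 - (s k + p k.+1)| <= alpha / 2) \/
  exists m, [/\ alpha / 2 <= u * (alpha * b ^+ m),
    exists2 k, (k < n)%N & alpha * b ^+ m <= `|s k + p k.+1| &
    forall k, (k < n)%N -> `|s k + p k.+1| < alpha * b ^+ m.+1].
- by rewrite (sum_error_uniform _ n h) ?orbT.
- apply/orP; left; move: (leqnn n) => nn.
  have [e [T [e0 T0 hE hB hP]]] := sum_error_invariant m n h nn hi.
  rewrite mulrAC ler_pdivlMr; last lra.
  have {hP} hP : alpha * b ^+ m + T <= mass n + e.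
    by case: hP => // -[/(_ k hk)]; rewrite ltNge kM.
  (* [(1 + n u) (e + T) <= n u (M + T - e)] amounts to
     [(1 + 2 n u) e + T <= n u M], which follows from [2 e + T <= n u M]. *)
  have h1 := ler_wpM2l nu0 hP.
  have h2 : `|err n| * (1 + n%:R * u) <= (e + T) * (1 + n%:R * u).
    by rewrite ler_wpM2r //; lra.
  have h3 : 0 <= e * (1 - 2 * n%:R * u) by rewrite mulr_ge0 //; lra.
  lra.
case: (posnP n) => [n0|n0]; first by left=> k; rewrite n0.
pose z (i : 'I_n) := `|s i + p i.+1|.
case: (@arg_maxP _ _ 'I_n (Ordinal n0) xpredT z isT) => j _ jmax.
have zmax k (hk : (k < n)%N) : `|s k + p k.+1| <= z j.
  exact: (jmax (Ordinal hk) isT).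
have [za|za] := ltrP (z j) alpha.
  left=> k hk; apply: nearest_underflow (s_step k hk) _.
  exact: le_lt_trans (zmax k hk) za.
have [m /andP[lo hi]] := binade_exists (s j + p j.+1) za.
have hi' k (hk : (k < n)%N) : `|s k + p k.+1| < alpha * b ^+ m.+1.
  exact: le_lt_trans (zmax k hk) hi.
have [h|h] := lerP (alpha / 2) (u * (alpha * b ^+ m)).
  by right; exists m; split=> //; exists j.
left=> k hk; have := nearest_upto_binade m _ _ (s_step k hk) (hi' k hk).
by rewrite (max_idPr (ltW h)).
Qed.

End Summation.

(** The partial sums become a sequence over [nat] by folding over the prefixes
    of the enumeration of the indices. *)
Lemma fl_sum_error (n : nat) (fl : 'I_n -> R -> R) (p : 'I_n.+1 -> R) :
  (forall k, rounds_to_nearest F (fl k)) -> (forall k, F (p k)) ->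
  2 * n%:R * u <= 1 ->
  `|fl_sum fl p - \sum_k p k| <=
    Num.max (n%:R * u / (1 + n%:R * u) * \sum_k `|p k|) (n%:R * (alpha / 2)).
Proof.
move=> hfl Fp hu; pose q (k : nat) := p (inord k).
pose s (k : nat) := foldl (fun t i => fl i (t + p (lift ord0 i))) (p ord0)
                          (take k (enum 'I_n)).
have s_step k : (k < n)%N -> nearest F (s k + q k.+1) (s k.+1).
  move=> hk; rewrite /s (take_nth (Ordinal hk)) ?size_enum_ord //.
  rewrite (nth_ord_enum _ (Ordinal hk)) foldl_rcons /q.
  have -> : inord k.+1 = lift ord0 (Ordinal hk).
    by apply: val_inj; rewrite /= inordK.
  exact: hfl.
have s0 : s 0%N = q 0%N.
  by rewrite /s take0 /q; congr p; apply: val_inj; rewrite /= inordK.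
have := float_sum_error (fun k _ => Fp (inord k)) s0 s_step hu.
rewrite {1}/s take_oversize ?size_enum_ord //.
under eq_bigr do rewrite /q inord_val.
by under [\sum_(i < n.+1) `|_|]eq_bigr do rewrite /q inord_val.
Qed.

Lemma sum_rounding_error (n : nat) (rd : 'I_n -> R -> R) (q : 'I_n -> R) :
  (forall k, rounds_to_nearest F (rd k)) ->
  \sum_k `|rd k (q k) - q k| <=
    u / (1 + u) * (\sum_k `|q k|) + n%:R * (alpha / 2).
Proof.
move=> hrd; rewrite mulr_sumr mulr_natl -[n in _ *+ n]card_ord -sumr_const.
rewrite -big_split; apply: ler_sum => k _.
exact: nearest_relative (hrd k (q k)).
Qed.

End RoundingToNearest.

(** * The dot product *)

(** The products add [v = u / (1 + u)] times the mass, and the sum adds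
    [c = n u / (1 + n u)] times the mass inflated by [1 + v]; the total is
    [(1 + c) v + c]. *)
Lemma combined_coefE {R : realType} (n : nat) (u : R) : 0 < u ->
  (1 + n%:R * u / (1 + n%:R * u)) * (u / (1 + u)) + n%:R * u / (1 + n%:R * u)
  = beta_coef n u * u.
Proof.
move=> u0; have nu0 : 0 <= n%:R * u by rewrite mulr_ge0 // ltW.
have h1 : 1 + u != 0 by rewrite gt_eqF //; lra.
have h2 : 1 + n%:R * u != 0 by rewrite gt_eqF //; lra.
rewrite /beta_coef.
have -> : 1 + (n%:R + 1) * u + n%:R * u ^+ 2 = (1 + u) * (1 + n%:R * u) by ring.
by field; apply/andP.
Qed.

(** After clearing denominators this is
    [n + 1 + 3 n u <= (n + 1) (1 + u) (1 + n u / 2)], whose terms of first order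
    in [u] compare by [(n - 1) (n - 2) >= 0]: with equality for [n = 1] and
    [n = 2], and true because [n] is an integer. *)
Lemma beta_coef_le {R : realType} (n : nat) (u : R) : 0 < u -> (1 <= n)%N ->
  beta_coef n u + (n%:R + 1) / 2 * (1 + n%:R * u / (1 + n%:R * u))
  <= 3 / 2 * (n%:R + 1).
Proof.
move=> u0 n1; have nu0 : 0 <= n%:R * u by rewrite mulr_ge0 // ltW.
have h2 : 1 + n%:R * u != 0 by rewrite gt_eqF //; lra.
rewrite /beta_coef.
have -> : 1 + (n%:R + 1) * u + n%:R * u ^+ 2 = (1 + u) * (1 + n%:R * u) by ring.
have -> : 3 / 2 * (n%:R + 1)
   = (n%:R + 1) * (1 + n%:R * u / 2) / (1 + n%:R * u)
     + (n%:R + 1) / 2 * (1 + n%:R * u / (1 + n%:R * u)) by field.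
rewrite lerD2r invfM mulrA ler_pM2r ?invr_gt0; last lra.
rewrite ler_pdivrMr; last lra.
have hn : 0 <= (n%:R - 1) * (n%:R - 2) :> R.
  case: n n1 {nu0 h2} => [|[|m]] // _; first by rewrite subrr mul0r.
  by rewrite mulr_ge0 // subr_ge0 ?ler1n ?ler_nat.
have h : 0 <= (n%:R - 1) * (n%:R - 2) * u by rewrite mulr_ge0 // ltW.
have h' : 0 <= (n%:R + 1) * (n%:R * u) * u.
  by rewrite !mulr_ge0 ?(ltW u0) //; have := ler0n R n; lra.
lra.
Qed.

Theorem corollary12 (R : realType) (beta mu : nat) (e_alpha : int)
    (hbeta : (2 <= beta)%N) (hmu : (1 <= mu)%N) (he : e_alpha < - mu%:Z)
    (n : nat) (hn : (1 <= n)%N)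
    (fl : 'I_n -> R -> R) (rd : 'I_n.+1 -> R -> R)
    (hfl : forall k : 'I_n, rounds_to_nearest (mpfr beta mu e_alpha) (fl k))
    (hrd : forall k : 'I_n.+1,
       rounds_to_nearest (mpfr beta mu e_alpha) (rd k))
    (x y : 'rV[R]_n.+1) :
  let u : R := unit_roundoff R beta mu in
  let alpha : R := mpfr_alpha R beta mu e_alpha in
  20 * n%:R * u <= 1 ->
  `|fl_dot fl rd x y - \sum_(k < n.+1) x 0 k * y 0 k|
     <= (205 / 100 * n%:R + 105 / 100) * alpha / 2
        + beta_coef n u * u * \sum_(k < n.+1) `|x 0 k * y 0 k|
  /\ (alpha <= u * \sum_(k < n.+1) `|x 0 k * y 0 k| ->
      `|fl_dot fl rd x y - \sum_(k < n.+1) x 0 k * y 0 k|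
        <= 3 / 2 * (n%:R + 1) * u * \sum_(k < n.+1) `|x 0 k * y 0 k|).
Proof.
move=> u alpha h20.
have u0 : 0 < u := roundoff_gt0 hbeta.
have a0 : 0 < alpha := alpha_gt0 hbeta.
have N0 : 0 <= n%:R :> R by [].
have nu0 : 0 <= n%:R * u by rewrite mulr_ge0 // ltW.
set Q : R := \sum_k `|_|; have Q0 : 0 <= Q by apply: sumr_ge0.
pose p k := rd k (x 0 k * y 0 k).
have Fp k : mpfr beta mu e_alpha (p k) by case: (hrd k (x 0 k * y 0 k)).
pose A : R := \sum_k `|p k|; pose P : R := \sum_k `|p k - x 0 k * y 0 k|.
have hS := fl_sum_error hbeta n fl p hfl Fp ltac:(rewrite -/u; lra).
have hP : P <= u / (1 + u) * Q + (n%:R + 1) * (alpha / 2).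
  rewrite natr1.
  exact: sum_rounding_error hbeta _ _ (fun k => x 0 k * y 0 k) hrd.
have hA : A <= Q + P.
  rewrite -big_split; apply: ler_sum => k _ /=.
  by rewrite -lerBlDl; apply: le_trans (lerB_dist _ _).
have hE : `|fl_dot fl rd x y - \sum_k x 0 k * y 0 k|
          <= `|fl_dot fl rd x y - \sum_k p k| + P.
  apply: le_trans (ler_distD (\sum_k p k) _ _) _; rewrite lerD2l -sumrB.
  exact: ler_norm_sum.
move: hE hS hP; rewrite -/u -/alpha -/A -/(fl_dot fl rd x y).
set E : R := `|_ - \sum_k x 0 k * y 0 k|; set S : R := `|_ - _| => hE.
set c := n%:R * u / (1 + n%:R * u); set v := u / (1 + u) => hS hP.
have c0 : 0 <= c by rewrite divr_ge0 //; lra.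
have c21 : c <= 1 / 21 by rewrite ler_pdivrMr //; lra.
have v0 : 0 <= v by rewrite divr_ge0 //; lra.
have vu : v <= u by rewrite ler_pdivrMr; [have := mulr_gt0 u0 u0|]; lra.
have coefE : (1 + c) * v + c = beta_coef n u * u by exact: combined_coefE.
have mass_case : S <= c * A ->
    E <= beta_coef n u * u * Q + (1 + c) * ((n%:R + 1) * (alpha / 2)).
  move=> h; have h1 := ler_wpM2l c0 hA.
  (* [E <= S + P <= c Q + (1 + c) P] *)
  have h2 := ler_wpM2l (addr_ge0 ler01 c0) hP.
  rewrite -coefE; lra.
have Na : 0 <= n%:R * alpha by rewrite mulr_ge0 // ltW.
have {hS} hS : S <= c * A \/ S <= n%:R * (alpha / 2).
  by apply/orP; rewrite -le_max.
split=> [|hQ].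
- case: hS => hc.
  (* the coefficient of [alpha / 2] is [(1 + c) (n + 1)], with
     [c <= 1 / 21] because [n u <= 1 / 20] *)
  + have := mass_case hc; have := ler_wpM2r (addr_ge0 Na (ltW a0)) c21; lra.
  + have : v * Q <= beta_coef n u * u * Q.
      by rewrite ler_wpM2r // -coefE; have := mulr_ge0 c0 v0; lra.
    lra.
- have NQ := ler_wpM2l N0 hQ.
  case: hS => hc.
  + have := mass_case hc.
    have := ler_wpM2r (mulr_ge0 (ltW u0) Q0) (beta_coef_le n u u0 hn).
    rewrite -/c => h1 h2.
    have := ler_wpM2l (addr_ge0 ler01 c0) (lerD NQ hQ); lra.
  + have := ler_wpM2r Q0 vu; lra.
Qed.
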